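(* Let $r_1,\ldots,r_s$ be positive integers and let $G$ be a connected nontraceable graph of order $n$, detour order $p$ and minimum degree $\delta(G)\ge k$. Then $$N(K_{r_1,\ldots,r_s},G)\le \max\{g_{r_1,\ldots,r_s}(n,p-1,k),\ g_{r_1,\ldots,r_s}(n,p-1,\lfloor (p-1)/2\rfloor)\}.$$
   Context: A graph is nontraceable if it has no Hamilton path. The detour order of a graph is the number of vertices of a longest path in it. For positive integers $r_1,\ldots,r_s$, $K_{r_1,\ldots,r_s}$ denotes the complete multipartite graph with $s$ parts of sizes $r_1,\ldots,r_s$. For graphs $H$ and $G$, $N(H,G)$ denotes the number of subgraphs of $G$ isomorphic to $H$. For integers $n,c,k$ with $k\ge 0$ and $n-1\ge c\ge 2k$, let $G(n,c,k)=K_k\vee\left(K_{c+1-2k}+\overline{K_{n-c-1+k}}\right)$, where $\vee$ denotes join (disjoint union plus all edges between the two graphs), $+$ denotes disjoint union, $K_m$ is the complete graph on $m$ vertices ($K_0$ empty), and $\overline{K_m}$ is the edgeless graph on $m$ vertices. Define $g_{r_1,\ldots,r_s}(n,c,k)=N(K_{r_1,\ldots,r_s},G(n,c,k))$. *)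

(* Defs.v *)
From mathcomp Require Import all_boot.

Set Implicit Arguments.
Unset Strict Implicit.
Unset Printing Implicit Defensive.

Record sgraph := SGraph {
  vert :> finType;
  adj : rel vert;
  adj_sym : symmetric adj;
  adj_irr : irreflexive adj
}.
Arguments adj {s} : rename.

Section Invariants.
Variable G : sgraph.

Definition connected : Prop :=
  0 < #|G| /\ forall x y : G, connect adj x y.

Definition degree (v : G) : nat := #|[set w : G | adj v w]|.

(* Every degree is smaller than #|G|, so for a nonempty graph the default value
   #|G| of the iterated minimum plays no role. *)
Definition min_degree : nat := \big[minn/#|G|]_(v : G) degree v.

(* A path, listed by its vertices from one end to the other; it has at least
   one vertex. *)
Definition is_path (q : seq G) : bool :=
  if q is x :: q' then path adj x q' && uniq q else false.

Definition hamilton_path (q : seq G) : Prop :=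
  is_path q /\ forall x : G, x \in q.

Definition nontraceable : Prop := ~ exists q : seq G, hamilton_path q.

(* A path has no repeated vertex, hence at most #|G| vertices. *)
Definition detour_order : nat :=
  \max_(m < #|G|.+1 | [exists q : m.-tuple G, is_path q]) m.

Definition edge_set : {set {set G}} :=
  [set [set u.1; u.2] | u in [set u : G * G | adj u.1 u.2]].

(* S.1 is the vertex set and S.2 the edge set; the subgraph need not be
   induced. *)
Definition is_subgraph (S : {set G} * {set {set G}}) : bool :=
  (S.2 \subset edge_set) && [forall e in S.2, e \subset S.1].

End Invariants.

(* f is an isomorphism from H onto the graph (S.1, S.2). *)
Definition is_iso (H G : sgraph) (S : {set G} * {set {set G}})
    (f : {ffun H -> G}) : bool :=
  [&& injectiveb f, f @: [set: H] == S.1 &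
      [forall x, forall y, adj x y == ([set f x; f y] \in S.2)]].

Definition nb_subgraphs (H G : sgraph) : nat :=
  #|[set S : {set G} * {set {set G}} |
      is_subgraph S & [exists f : {ffun H -> G}, is_iso S f]]|.

Section Complete.
Variable n : nat.

Definition complete_adj : rel 'I_n := fun x y => x != y.

Lemma complete_sym : symmetric complete_adj.
Proof. by move=> x y; rewrite /complete_adj eq_sym. Qed.

Lemma complete_irr : irreflexive complete_adj.
Proof. by move=> x; rewrite /complete_adj eqxx. Qed.

Definition complete : sgraph := SGraph complete_sym complete_irr.

Definition edgeless_adj : rel 'I_n := fun _ _ => false.

Lemma edgeless_sym : symmetric edgeless_adj.
Proof. by []. Qed.

Lemma edgeless_irr : irreflexive edgeless_adj.
Proof. by []. Qed.

Definition edgeless : sgraph := SGraph edgeless_sym edgeless_irr.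

End Complete.

Section Sums.
Variables G H : sgraph.

(* Vertices on different sides are adjacent exactly when b is true. *)
Definition sum_adj (b : bool) : rel (G + H)%type := fun u v =>
  match u, v with
  | inl x, inl y => adj x y
  | inr x, inr y => adj x y
  | _, _ => b
  end.

Lemma sum_sym b : symmetric (sum_adj b).
Proof. by move=> [x|x] [y|y] //=; exact: adj_sym. Qed.

Lemma sum_irr b : irreflexive (sum_adj b).
Proof. by move=> [x|x] /=; exact: adj_irr. Qed.

Definition join : sgraph := SGraph (sum_sym true) (sum_irr true).

Definition disjoint_union : sgraph := SGraph (sum_sym false) (sum_irr false).

End Sums.

Section Multipartite.
Variables (s : nat) (r : 'I_s -> nat).

Definition multipartite_adj : rel {i : 'I_s & 'I_(r i)} :=
  fun u v => tag u != tag v.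

Lemma multipartite_sym : symmetric multipartite_adj.
Proof. by move=> u v; rewrite /multipartite_adj eq_sym. Qed.

Lemma multipartite_irr : irreflexive multipartite_adj.
Proof. by move=> u; rewrite /multipartite_adj eqxx. Qed.

Definition complete_multipartite : sgraph :=
  SGraph multipartite_sym multipartite_irr.

End Multipartite.

(* Meaningful for 2 * k <= c <= n - 1, where no subtraction is truncated. *)
Definition extremal_graph (n c k : nat) : sgraph :=
  join (complete k)
    (disjoint_union (complete (c + 1 - 2 * k)) (edgeless (n - c - 1 + k))).

Definition g_multipartite (s : nat) (r : 'I_s -> nat) (n c k : nat) : nat :=
  nb_subgraphs (complete_multipartite r) (extremal_graph n c k).

(* Main.v *)
Require Import Defs.
From mathcomp Require Import all_boot zify.

Set Implicit Arguments.
Unset Strict Implicit.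
Unset Printing Implicit Defensive.

(* Copies of H = K_(r_1, ..., r_s) are counted as injective homomorphisms, of
   which each copy accounts for |Aut H|.  If w has degree at most j in an
   N-vertex graph, the homomorphisms that meet w are at most as many as for a
   vertex of the independent part of the extremal graph: when x is mapped to w,
   the neighbours of x go to N(w) and the other vertices of H, which are the
   rest of the class of x, go anywhere.  Hence removing vertices of degree at
   most j until p - j remain gives
   N(H, G) <= g(n, p - 1, j), and g(n, p - 1, j) is convex in j.

   That such a removal exists for j = floor((p - 1)/2) or for some j between k
   and floor((p - 1)/2) is Kopylov's argument.  Add edges to G as long as no
   path gets more than p vertices, let t = floor((p - 1)/2), and let K be a
   largest set inducing minimum degree > t.  If K is empty take j = t.
   Otherwise K is a clique, and j = p - |K| works, since a larger set of
   minimum degree > j would be completely joined to K, against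
   maximality.  Both facts hold because two nonadjacent vertices of sets with minimum degrees a and b, a + b >= p,
   can be chosen with a longest possible path between them in the join of G with
   a vertex; Posa's rotation turns this path into a cycle with more than p + 1
   vertices, or else connectivity of G yields a path on more than p vertices. *)

(** * Copies and embeddings *)

Section Embeddings.
Variables (H : sgraph) (T : finType).

Definition embeddings (e : rel T) (W : {set T}) : {set {ffun H -> T}} :=
  [set f : {ffun H -> T} | [&& injectiveb f, [forall x, f x \in W] &
     [forall x, forall y, adj x y ==> e (f x) (f y)]]].

Lemma embeddingsP (e : rel T) (W : {set T}) (f : {ffun H -> T}) :
  reflect [/\ injective f, forall x, f x \in W &
             forall x y, adj x y -> e (f x) (f y)]
          (f \in embeddings e W).
Proof.
rewrite inE; apply: (iffP and3P) => [[/injectiveP fI /forallP fW /forallP fe]|].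
  by split=> // x y; move/forallP: (fe x) => /(_ y)/implyP.
case=> fI fW fe; split; first exact/injectiveP.
  exact/forallP.
by apply/forallP=> x; apply/forallP=> y; apply/implyP/fe.
Qed.

Lemma leq_embeddings (e1 e2 : rel T) (W : {set T}) :
  subrel e1 e2 -> #|embeddings e1 W| <= #|embeddings e2 W|.
Proof.
move=> e12; apply/subset_leq_card/subsetP=> f /embeddingsP[fI fW fe].
by apply/embeddingsP; split=> // x y /fe/e12.
Qed.

End Embeddings.

Section Copies.
Variables H G : sgraph.

Definition automorphisms : {set {ffun H -> H}} :=
  [set s : {ffun H -> H} |
     injectiveb s && [forall x, forall y, adj (s x) (s y) == adj x y]].

Lemma automorphisms_gt0 : 0 < #|automorphisms|.
Proof.
apply/card_gt0P; exists [ffun x => x]; rewrite inE; apply/andP; split.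
  by apply/injectiveP=> x y; rewrite !ffunE.
by apply/forallP=> x; apply/forallP=> y; rewrite !ffunE.
Qed.

Definition copy (f : {ffun H -> G}) : {set G} * {set {set G}} :=
  (f @: [set: H],
   [set [set f u.1; f u.2] | u in [set u : H * H | adj u.1 u.2]]).

Lemma set2_inj (T : finType) (a b c d : T) :
  [set a; b] = [set c; d] -> (a = c /\ b = d) \/ (a = d /\ b = c).
Proof.
move=> E.
have: a \in [set c; d] by rewrite -E !inE eqxx.
have: b \in [set c; d] by rewrite -E !inE eqxx orbT.
have: c \in [set a; b] by rewrite E !inE eqxx.
have: d \in [set a; b] by rewrite E !inE eqxx orbT.
rewrite !inE => /orP[]/eqP-> /orP[]/eqP-> /orP[]/eqP? /orP[]/eqP?; subst; tauto.
Qed.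

Lemma copy_adj (f : {ffun H -> G}) x y :
  injective f -> ([set f x; f y] \in (copy f).2) = adj x y.
Proof.
move=> fI; apply/imsetP/idP=> [[[u v] /=]|xy].
  by rewrite inE /= => uv /set2_inj[][/fI-> /fI->] //; rewrite adj_sym.
by exists (x, y); rewrite ?inE.
Qed.

(** An isomorphism determines its target: every edge of [S] has its ends in [S.1], the image of [f],
    so it comes from an edge of [H]. Pairs of a subgraph and an isomorphism onto it are therefore
    the same as embeddings. *)
Lemma copyP (f : {ffun H -> G}) (S : {set G} * {set {set G}}) :
  (is_subgraph S && is_iso S f)
  = (f \in embeddings H (@adj G) setT) && (copy f == S).
Proof.
apply/idP/idP=> [/andP[/andP[Se SV] /and3P[/injectiveP fI /eqP fS fadj]]|].
  have iso x y : adj x y = ([set f x; f y] \in S.2).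
    by move/forallP: fadj => /(_ x)/forallP/(_ y)/eqP.
  apply/andP; split.
    apply/embeddingsP; split=> // x y; rewrite iso => /(subsetP Se)/imsetP[[u v]].
    by rewrite inE /= => uv /set2_inj[][-> ->] //; rewrite adj_sym.
  rewrite eqE /= fS eqxx /=; apply/eqP/setP=> E; apply/imsetP/idP.
    by case=> [[u v]]; rewrite inE iso => uv ->.
  move=> ES; have/imsetP[[a b]] := subsetP Se _ ES.
  rewrite inE /= => ab EE.
  have/subsetP EV : E \subset S.1 by apply: (implyP (forallP SV E)).
  have /imsetP[x _ ax]: a \in f @: [set: H] by rewrite fS EV // EE !inE eqxx.
  have /imsetP[y _ cy]: b \in f @: [set: H] by rewrite fS EV // EE !inE eqxx orbT.
  by exists (x, y) => /=; rewrite -?ax -?cy // inE /= iso -ax -cy -EE.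
case/andP=> /embeddingsP[fI _ fe] /eqP<-; apply/andP; split.
  apply/andP; split.
    apply/subsetP=> _ /imsetP[[x y] /[!inE]/= xy ->].
    by apply/imsetP; exists (f x, f y); rewrite // inE /= fe.
  apply/forallP=> E; apply/implyP=> /imsetP[[x y] _ ->].
  by rewrite subUset !sub1set !imset_f.
apply/and3P; split=> //; first exact/injectiveP.
by apply/forallP=> x; apply/forallP=> y; rewrite copy_adj.
Qed.

(** The embeddings are grouped by their [copy]. Once [f0] is fixed in a fibre, composing it with the
    automorphisms of [H] reaches each member of the fibre exactly once. *)
Lemma nb_subgraphs_automorphisms :
  nb_subgraphs H G * #|automorphisms| = #|embeddings H (@adj G) setT|.
Proof.
rewrite -[RHS]sum1_card.
pose N := [set S : {set G} * {set {set G}} |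
  is_subgraph S & [exists f : {ffun H -> G}, is_iso S f]].
rewrite (partition_big copy (mem N)) /=; last first.
  move=> f fE; have:= copyP f (copy f); rewrite fE eqxx /= => /andP[Sf If].
  by rewrite inE Sf; apply/existsP; exists f.
rewrite -[LHS]sum_nat_const; apply: eq_bigr => S.
rewrite inE => /andP[Ss /existsP[f0 If0]].
have/andP[/embeddingsP[f0I _ f0e] /eqP f0S]: (f0 \in embeddings H (@adj G) setT) &&
  (copy f0 == S) by rewrite -copyP Ss.
pose comp (s : {ffun H -> H}) := [ffun x => f0 (s x)].
have compI : injective comp.
  move=> s1 s2 /ffunP E; apply/ffunP=> x; apply: f0I.
  by have:= E x; rewrite !ffunE.
rewrite sum1dep_card -(card_imset _ compI); apply: eq_card => g.
rewrite [RHS]inE -copyP Ss /=; apply/imsetP/idP.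
  case=> s; rewrite inE => /andP[/injectiveP sI /forallP sA] ->.
  have [_ f0V _] := and3P If0.
  apply/and3P; split.
  - by apply/injectiveP=> x y; rewrite !ffunE => /f0I/sI.
  - rewrite -(eqP f0V); apply/eqP/setP=> v; apply/imsetP/imsetP.
      by case=> x _ ->; exists (s x); rewrite ?ffunE.
    case=> x _ ->; have [s' _ sK] := injF_bij sI.
    by exists (s' x); rewrite // ffunE sK.
  - apply/forallP=> x; apply/forallP=> y; rewrite !ffunE -f0S copy_adj //.
    by rewrite eq_sym; exact: (forallP (sA x) y).
move=> Ig; have/andP[/embeddingsP[gI _ ge] /eqP gS]: (g \in embeddings H (@adj G) setT) &&
  (copy g == S) by rewrite -copyP Ss.
have ex x : exists y, f0 y == g x.
  have: g x \in (copy g).1 by apply: imset_f.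
  by rewrite gS -f0S => /imsetP[y _ ->]; exists y.
pose s := [ffun x => xchoose (ex x)].
have sE x : f0 (s x) = g x by rewrite ffunE; apply/eqP/(xchooseP (ex x)).
exists s; last by apply/ffunP=> x; rewrite ffunE sE.
rewrite inE; apply/andP; split.
  by apply/injectiveP=> x y sxy; apply: gI; rewrite -!sE sxy.
apply/forallP=> x; apply/forallP=> y.
by rewrite -(copy_adj _ _ f0I) f0S -gS !sE copy_adj.
Qed.

End Copies.

(** * Counting injections one value at a time *)

Section InjectiveChoices.
Variables (D T : finType) (t0 : T) (B : D -> {set T}).

(* A partial function on s is represented by the value t0 outside s. *)
Definition inj_choices (s : seq D) : {set {ffun D -> T}} :=
  [set f : {ffun D -> T} | [&& uniq (map f s), all (fun y => f y \in B y) s &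
     [forall y, (y \notin s) ==> (f y == t0)]]].

Lemma inj_choicesP (s : seq D) (f : {ffun D -> T}) :
  reflect [/\ uniq (map f s), {in s, forall y, f y \in B y} &
             forall y, y \notin s -> f y = t0]
          (f \in inj_choices s).
Proof.
rewrite inE; apply: (iffP and3P) => [[U /allP A /forallP F]|[U A F]].
  by split=> // y ys; apply/eqP/(implyP (F y)).
split=> //; first exact/allP.
by apply/forallP=> y; apply/implyP=> /F->.
Qed.

Lemma card_inj_choices0 : #|inj_choices [::]| = 1.
Proof.
apply/eqP/cards1P; exists [ffun => t0]; apply/setP=> f; rewrite [RHS]inE.
apply/inj_choicesP/eqP=> [[_ _ F]|->].
  by apply/ffunP=> y; rewrite ffunE F.
by split=> // y _; rewrite ffunE.
Qed.

(** Forgetting the value at [z] maps onto the choices on [s], and every fibre has the same size [c],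
    the number of values still free for [z]. *)
Lemma card_inj_choices_cons (z : D) (s : seq D) (c : nat) :
    z \notin s ->
    {in inj_choices s, forall f : {ffun D -> T}, #|[set v in B z | v \notin map f s]| = c} ->
  #|inj_choices (z :: s)| = #|inj_choices s| * c.
Proof.
move=> zs cE.
pose forget (f : {ffun D -> T}) := [ffun y => if y == z then t0 else f y].
pose extend (f : {ffun D -> T}) v := [ffun y => if y == z then v else f y].
have map_upd (f : {ffun D -> T}) v :
    [seq [ffun y => if y == z then v else f y] y | y <- s] = map f s.
  apply/eq_in_map=> y ys; rewrite ffunE; case: eqP => // yz.
  by rewrite -yz ys in zs.
rewrite -[LHS]sum1_card (partition_big forget (mem (inj_choices s))) /=; last first.
  move=> f /inj_choicesP[/= /andP[_ U] A F]; apply/inj_choicesP; split.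
  - by rewrite map_upd.
  - move=> y ys; rewrite ffunE; case: eqP => [yz|_]; first by rewrite -yz ys in zs.
    by apply: A; rewrite inE ys orbT.
  - move=> y ys; rewrite ffunE; case: eqP => // yz; apply: F.
    by rewrite inE (negPf ys) orbF; apply/eqP.
rewrite -sum_nat_const; apply: eq_bigr => g gS; rewrite sum1dep_card -(cE g gS).
have extI : injective (extend g).
  by move=> v w /ffunP/(_ z); rewrite !ffunE eqxx.
have [U A F] := inj_choicesP _ _ gS.
rewrite -(card_imset _ extI); apply: eq_card => f; rewrite [LHS]inE.
apply/andP/imsetP.
  case=> /inj_choicesP[/= /andP[fz fU] fA fF] /eqP gE.
  exists (f z); first by rewrite inE fA ?mem_head //= -gE map_upd.
  by apply/ffunP=> y; rewrite -gE !ffunE; case: eqP => // ->.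
case=> v; rewrite inE => /andP[vB vg] ->; split.
  apply/inj_choicesP; split.
  - by rewrite /= map_upd ffunE eqxx vg.
  - by move=> y; rewrite ffunE inE; case: eqP => [->|_ /= ys] //; apply: A.
  - by move=> y; rewrite ffunE inE; case: eqP => //= _; apply: F.
apply/eqP/ffunP=> y; rewrite !ffunE; case: eqP => // ->.
by rewrite F.
Qed.

End InjectiveChoices.

Section PinnedInjections.
Variables (D T : finType) (x : D) (w : T) (O : {set D}) (J W : {set T}).
Hypotheses (xO : x \notin O) (JW : J \subset W) (wW : w \in W) (wJ : w \notin J).

Definition pinned_injections : {set {ffun D -> T}} :=
  [set f : {ffun D -> T} | [&& injectiveb f, f x == w, f @: O \subset J &
     [forall y, f y \in W]]].

Lemma pinned_injectionsP (f : {ffun D -> T}) :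
  reflect [/\ injective f, f x = w, {in O, forall y, f y \in J} &
             forall y, f y \in W]
          (f \in pinned_injections).
Proof.
rewrite inE; apply: (iffP and4P) => [[/injectiveP I /eqP E /subsetP S /forallP F]|[I E S F]].
  by split=> // y yO; apply/S/imset_f.
split; [exact/injectiveP | exact/eqP | | exact/forallP].
by apply/subsetP=> _ /imsetP[y yO ->]; apply: S.
Qed.

Lemma card_pinned_injections :
  #|pinned_injections|
  = #|J| ^_ #|O| * (#|W| - 1 - #|O|) ^_ (#|D| - 1 - #|O|).
Proof.
(* Values are chosen first at [x], then on [O], then elsewhere; lists grow at the head, so [x]
   stands last. Since [w] is outside [J], the choice at [x] takes nothing from [J], but it takes one
   value from [W]. *)
pose B y := if y == x then [set w] else if y \in O then J else W.
pose S := inj_choices w B.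
have Bx : B x = [set w] by rewrite /B eqxx.
have xneq y : y \in O -> y != x by apply: contraL => /eqP->.
have BW y : B y \subset W.
  by rewrite /B; case: eqP => _; [rewrite sub1set | case: ifP].
have Sx : #|S [:: x]| = 1.
  rewrite (@card_inj_choices_cons _ _ _ _ _ _ 1) ?card_inj_choices0 // => f _.
  by rewrite -(cards1 w); apply: eq_card => v; rewrite Bx !inE andbT.
have Ostep l : {subset l <= O} -> uniq l -> #|S (rcons l x)| = #|J| ^_ (size l).
  elim: l => [|z l IH] lO /=; first by rewrite Sx ffactn0.
  case/andP=> zl Ul; have zO : z \in O by rewrite lO ?mem_head.
  have {}lO : {subset l <= O} by move=> y yl; rewrite lO // inE yl orbT.
  rewrite (@card_inj_choices_cons _ _ _ _ _ _ (#|J| - size l)).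
  - by rewrite -/S IH // ffactnSr.
  - by rewrite mem_rcons inE negb_or xneq.
  move=> f /inj_choicesP[U A _].
  have fl : {subset map f l <= J}.
    move=> _ /mapP[y yl ->]; have: f y \in B y by apply: A; rewrite mem_rcons inE yl orbT.
    by rewrite /B (negPf (xneq _ (lO _ yl))) lO.
  have fx : f x = w.
    by apply/eqP; rewrite -in_set1 -Bx; apply: A; rewrite mem_rcons mem_head.
  rewrite /B (negPf (xneq _ zO)) zO.
  have -> : [set v in J | v \notin map f (rcons l x)] = J :\: [set v in map f l].
    apply/setP=> v; rewrite !inE map_rcons mem_rcons inE fx negb_or andbC.
    by case: eqP => [->|_] //=; rewrite (negPf wJ) andbF.
  rewrite cardsD (setIidPr _); last by apply/subsetP=> v; rewrite inE; apply: fl.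
  rewrite cardsE (card_uniqP _) ?size_map //.
  by move: U; rewrite map_rcons rcons_uniq => /andP[].
pose s0 := rcons (enum O) x.
have mem_s0 y : (y \in s0) = (y == x) || (y \in O).
  by rewrite mem_rcons inE mem_enum.
have Cstep l : {in l, forall y, y \notin s0} -> uniq l ->
    #|S (l ++ s0)| = #|J| ^_ #|O| * (#|W| - 1 - #|O|) ^_ (size l).
  elim: l => [|z l IH] ls /=.
    rewrite ffactn0 muln1 Ostep ?cardE ?enum_uniq //.
    by move=> y; rewrite mem_enum.
  case/andP=> zl Ul; have zs : z \notin s0 by rewrite ls ?mem_head.
  have {}ls : {in l, forall y, y \notin s0} by move=> y yl; rewrite ls // inE yl orbT.
  rewrite (@card_inj_choices_cons _ _ _ _ _ _ (#|W| - 1 - #|O| - size l)).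
  - by rewrite -/S IH // ffactnSr mulnA.
  - by rewrite mem_cat negb_or zl.
  move=> f /inj_choicesP[U A _].
  have Bz : B z = W by move: zs; rewrite /B mem_s0; case: eqP => //= _ /negPf->.
  have -> : [set v in B z | v \notin map f (l ++ s0)]
            = W :\: [set v in map f (l ++ s0)].
    by apply/setP=> v; rewrite Bz !inE andbC.
  rewrite cardsD (setIidPr _); last first.
    apply/subsetP=> v; rewrite inE => /mapP[y /A yB ->].
    exact: (subsetP (BW y)).
  rewrite cardsE (card_uniqP _) // size_map size_cat size_rcons -cardE.
  by rewrite -!subnDA add1n addnC.
pose C := [set y | y \notin s0].
have -> : pinned_injections = S (enum C ++ s0).
  have memC y : y \in enum C ++ s0.
    by rewrite mem_cat mem_enum inE orNb.
  apply/setP=> f; apply/pinned_injectionsP/inj_choicesP.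
    case=> fI fx fO fW; split=> [||y]; last by rewrite memC.
    - rewrite map_inj_uniq // cat_uniq enum_uniq rcons_uniq mem_enum xO enum_uniq.
      rewrite /= andbT; apply/hasPn=> y ys; rewrite mem_enum inE.
      by rewrite ys.
    - move=> y _; rewrite /B; case: eqP => [->|_]; first by rewrite fx set11.
      by case: ifP => [/fO|].
  case=> U A _; split.
  - apply/injectiveP; rewrite /injectiveb /dinjectiveb.
    rewrite -(@perm_uniq _ (map f (enum C ++ s0))) // perm_map // uniq_perm ?enum_uniq //.
      by move: U => /map_uniq.
    by move=> y; rewrite memC mem_enum.
  - by apply/eqP; rewrite -in_set1 -Bx A.
  - by move=> y yO; have := A y (memC y); rewrite /B (negPf (xneq _ yO)) yO.
  - by move=> y; apply/(subsetP (BW y))/A.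
rewrite Cstep ?enum_uniq //; last by move=> y; rewrite mem_enum inE.
congr (_ * _ ^_ _); rewrite -cardE.
have -> : C = ~: (x |: O) by apply/setP=> y; rewrite !inE mem_s0.
by rewrite cardsCs setCK cardsU1 xO -subnDA.
Qed.

End PinnedInjections.

(** * Removing vertices of small degree *)

Section Removal.
Variable H : sgraph.

(* For H complete multipartite, the number of embeddings of H into an N-vertex
   graph that use a given vertex of degree j whose neighbours are adjacent to all
   other vertices; the summand counts those mapping x to it. *)
Definition removal_weight (N j : nat) : nat :=
  \sum_(x : H) j ^_ degree x * (N - 1 - degree x) ^_ (#|H| - 1 - degree x).

(* For H complete multipartite and m = p - j, the number of embeddings of H into
   [extremal_graph n (p - 1) j]. *)
Definition removal_bound (n m j : nat) : nat :=
  m ^_ #|H| + \sum_(m.+1 <= N < n.+1) removal_weight N j.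

Variables (T : finType) (e : rel T).

Lemma leq_card_bigcup (I S : finType) (A : I -> {set S}) :
  #|\bigcup_i A i| <= \sum_i #|A i|.
Proof.
elim/big_rec2: _ => [|i n B _ leB]; first by rewrite cards0.
by apply: leq_trans (leq_card_setU _ _) _; rewrite leq_add2l.
Qed.

Lemma leq_ffact2r (k m n : nat) : m <= n -> m ^_ k <= n ^_ k.
Proof.
elim: k m n => [|k IH] [|m] [|n] // mn.
by rewrite !ffactnS leq_mul //= IH.
Qed.

(** An embedding either avoids [w] or maps some [x] to [w]; in the latter case it is a pinned
    injection sending the neighbours of [x] into [J]. The adjacencies among the other vertices are
    dropped, which only increases the count. *)
Lemma embeddings_removal (W : {set T}) (w : T) (j : nat) :
    irreflexive e -> w \in W -> #|[set v in W | e w v]| <= j ->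
  #|embeddings H e W| <= #|embeddings H e (W :\ w)| + removal_weight #|W| j.
Proof.
move=> eI wW dw; set J := [set v in W | e w v].
pose P (x : H) := pinned_injections x w [set y | adj x y] J W.
have sub : embeddings H e W \subset embeddings H e (W :\ w) :|: \bigcup_x P x.
  apply/subsetP=> f /embeddingsP[fI fW fe]; rewrite inE.
  have [/existsP[x /eqP fx]|/existsPn nfx] := boolP [exists x, f x == w].
    apply/orP; right; apply/bigcupP; exists x => //.
    apply/pinned_injectionsP; split=> // y; rewrite !inE => /fe.
    by rewrite fW fx.
  apply/orP; left; apply/embeddingsP; split=> // x.
  by rewrite !inE fW nfx.
apply: leq_trans (subset_leq_card sub) _.
apply: leq_trans (leq_card_setU _ _) _; rewrite leq_add2l.
apply: leq_trans (leq_card_bigcup _) _; apply: leq_sum => x _.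
rewrite card_pinned_injections //.
- by rewrite leq_mul // leq_ffact2r.
- by rewrite inE adj_irr.
- by apply/subsetP=> v; rewrite inE => /andP[].
- by rewrite inE eI andbF.
Qed.

Lemma embeddings_ffact (W : {set T}) : #|embeddings H e W| <= #|W| ^_ #|H|.
Proof.
rewrite -card_inj_ffuns_on; apply/subset_leq_card/subsetP=> f.
case/embeddingsP=> fI fW _; rewrite inE; apply/andP; split.
  exact/ffun_onP.
exact/injectiveP.
Qed.

(** Sparse vertices are removed one at a time until [m] remain; what is left has at most [m ^_ #|H|]
    embeddings. *)
Lemma embeddings_le_removal_bound (m j : nat) (W : {set T}) :
    irreflexive e -> m <= #|W| ->
    (forall U : {set T}, m < #|U| ->
       exists2 w, w \in U & #|[set v in U | e w v]| <= j) ->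
  #|embeddings H e W| <= removal_bound #|W| m j.
Proof.
move=> eI mW sparse; move En : #|W| => n; rewrite En in mW.
elim: n W En mW => [|n IH] W En mW.
  move: mW; rewrite leqn0 => /eqP->.
  rewrite /removal_bound big_geq // addn0 -En.
  exact: embeddings_ffact.
have [mn|] := ltnP m n.+1; last first.
  move=> nm; have mE : m = n.+1 by apply/eqP; rewrite eqn_leq mW nm.
  rewrite /removal_bound -mE big_geq // addn0 mE -En.
  exact: embeddings_ffact.
have [|w wW dw] := sparse W; first by rewrite En.
have := cardsD1 w W; rewrite wW En add1n => -[] Ew.
apply: leq_trans (embeddings_removal eI wW dw) _.
rewrite /removal_bound big_nat_recr //= addnA En leq_add2r.
by apply: IH.
Qed.

(** The converse of the removal estimate. By the hypothesis on [H], every edge of [H] has an end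
    adjacent to [x]; a pinned injection puts this end in [J], whose vertices are adjacent to all
    others. So every pinned injection is an embedding. *)
Lemma removal_embeddings (J W : {set T}) (w : T) :
    (forall x y z : H, adj y z -> adj x y || adj x z) ->
    w \in W -> J \subset W :\ w ->
    {in J, forall u v, u != v -> e u v && e v u} ->
  #|embeddings H e (W :\ w)| + removal_weight #|W| #|J| <= #|embeddings H e W|.
Proof.
move=> multi wW JW univ.
have wJ : w \notin J by apply/negP=> /(subsetP JW); rewrite !inE eqxx.
pose P (x : H) := pinned_injections x w [set y | adj x y] J W.
have -> : removal_weight #|W| #|J| = #|\bigcup_x P x|.
  rewrite -[RHS]sum1_card partition_disjoint_bigcup /=; last first.
    move=> x y xy; rewrite -setI_eq0; apply/eqP/setP=> f; rewrite in_set0.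
    apply/negP=> /setIP[/pinned_injectionsP[fI fx _ _] /pinned_injectionsP[_ fy _ _]].
    by case/eqP: xy; apply: fI; rewrite fx.
  apply: eq_bigr => x _; rewrite sum1_card card_pinned_injections //.
    by rewrite inE adj_irr.
  exact: subset_trans JW (subD1set _ _).
rewrite -cardsUI [_ :&: \bigcup_x _](_ : _ = set0) ?cards0 ?addn0; last first.
  apply/setP=> f; rewrite in_set0; apply/negP.
  case/setIP=> /embeddingsP[_ fW _] /bigcupP[x _ /pinned_injectionsP[_ fx _ _]].
  by have := fW x; rewrite fx !inE eqxx.
apply/subset_leq_card/subsetP=> f /setUP[|/bigcupP[x _]].
  case/embeddingsP=> fI fW fe; apply/embeddingsP; split=> // x.
  by have := fW x; rewrite inE => /andP[].
case/pinned_injectionsP=> fI fx fJ fW; apply/embeddingsP; split=> // y z yz.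
have yzneq : f y != f z.
  by apply: contraTneq yz => /fI->; rewrite adj_irr.
have [xy|xz] := orP (multi x y z yz).
  have fyJ : f y \in J by apply: fJ; rewrite inE.
  by case/andP: (univ _ fyJ _ yzneq).
have fzJ : f z \in J by apply: fJ; rewrite inE.
by rewrite eq_sym in yzneq; case/andP: (univ _ fzJ _ yzneq).
Qed.

(** All injections into the clique [A] are embeddings; the vertices outside [A] are then put back
    one by one. *)
Lemma removal_bound_le_embeddings (J A W : {set T}) :
    (forall x y z : H, adj y z -> adj x y || adj x z) ->
    J \subset A -> A \subset W ->
    {in A &, forall u v, u != v -> e u v} ->
    {in J, forall u v, u != v -> e u v && e v u} ->
  removal_bound #|W| #|A| #|J| <= #|embeddings H e W|.
Proof.
move=> multi JA AW Acl univ; move Ed : #|W :\: A| => d.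
elim: d W Ed AW => [|d IH] W Ed AW.
  move/eqP: Ed; rewrite cards_eq0 setD_eq0 => WA.
  have -> : W = A by apply/eqP; rewrite eqEsubset WA.
  rewrite /removal_bound big_geq // addn0 -card_inj_ffuns_on.
  apply/subset_leq_card/subsetP=> f; rewrite inE => /andP[/ffun_onP fA /injectiveP fI].
  apply/embeddingsP; split=> // x y xy; apply: Acl => //.
  by apply: contraTneq xy => /fI->; rewrite adj_irr.
have /card_gt0P[w wWA] : 0 < #|W :\: A| by rewrite Ed.
have /setDP[wW wA] := wWA.
have AWw : A \subset W :\ w by rewrite subsetD1 AW.
have Ew : #|W| = #|W :\ w|.+1 by rewrite (cardsD1 w) wW.
apply: leq_trans (removal_embeddings multi wW (subset_trans JA AWw) univ).
rewrite /removal_bound Ew big_nat_recr /=; last by rewrite ltnS subset_leq_card.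
rewrite addnA leq_add2r; apply: IH => //.
by apply/eqP; rewrite -eqSS -Ed (cardsD1 w (W :\: A)) wWA setDDl setUC -setDDl.
Qed.
End Removal.

(** * Convexity of the bound *)

Lemma ffactSS_rec (n m : nat) : n.+1 ^_ m.+1 = n ^_ m.+1 + m.+1 * n ^_ m.
Proof.
rewrite ffactSS ffactnSr [n ^_ m * _]mulnC -mulnDl.
have [mn|nm] := leqP m n; first by rewrite addnS subnK.
by rewrite ffact_small // !muln0.
Qed.

Lemma ffactnD (n a b : nat) : n ^_ (a + b) = n ^_ a * (n - a) ^_ b.
Proof.
by elim: b => [|b IH]; rewrite ?addn0 ?muln1 // addnS !ffactnSr IH mulnA subnDA.
Qed.

Lemma ffact_diff_leq (d i j : nat) :
  i <= j -> i.+1 ^_ d - i ^_ d <= j.+1 ^_ d - j ^_ d.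
Proof.
case: d => [|d] ij //.
by rewrite !ffactSS_rec !addKn leq_mul2l leq_ffact2r.
Qed.

Section Convexity.
Variable H : sgraph.

Lemma degree_ltn (x : H) : degree x < #|H|.
Proof.
rewrite -cardsT; apply/proper_card/properP; split; first exact: subsetT.
by exists x; rewrite ?inE // adj_irr.
Qed.

(** Counts the injections into a clique that gains one vertex: with [j = M] the new vertex sees all
    others, and each summand collapses to [M ^_ (#|H| - 1)]. *)
Lemma ffact_removal (M : nat) :
  M.+1 ^_ #|H| = M ^_ #|H| + removal_weight H M.+1 M.
Proof.
have -> : removal_weight H M.+1 M = #|H| * M ^_ #|H|.-1.
  rewrite -sum_nat_const; apply: eq_bigr => x _; have := degree_ltn x.
  rewrite subn1 -ffactnD; case: #|H| => // h.
  by rewrite ltnS subn1 => /subnKC->.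
by case: #|H| => [|h]; [rewrite mul0n addn0 | rewrite ffactSS_rec].
Qed.

Lemma leq_removal_weight (N i j : nat) :
  i <= j -> removal_weight H N i <= removal_weight H N j.
Proof. by move=> ij; apply: leq_sum => x _; rewrite leq_mul // leq_ffact2r. Qed.

Section Fixed.
Variables n p : nat.

Let phi j := removal_bound H n (p - j) j.
(* The forward difference of phi, split into two natural numbers that are both
   monotone in j. *)
Let loss j := removal_weight H (p - j) (p - j).-1 - removal_weight H (p - j) j.+1.
Let gain j := \sum_((p - j).+1 <= N < n.+1)
  (removal_weight H N j.+1 - removal_weight H N j).

(** Passing from [j] to [j.+1] turns one clique vertex into a vertex of degree [j.+1], which costs
    [loss], and raises the degree of each later vertex by one, which brings [gain]. The bound on [j]
    keeps the subtraction in [loss] from being truncated. *)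
Lemma removal_bound_step (j : nat) :
  p <= n -> j.*2.+1 < p -> phi j.+1 + loss j = phi j + gain j.
Proof.
move=> pn jp; have [M ME] : exists M, p - j = M.+1.
  exists (p - j).-1; rewrite prednK // subn_gt0; apply: leq_ltn_trans jp.
  by rewrite -addnn leqW ?leq_addr.
have jM : j < M.
  by rewrite -ltnS -ME ltn_subRL addnS addnn.
rewrite /phi /loss /gain /removal_bound subnS ME /= ffact_removal.
have Mn : M < n by rewrite -ME; apply: leq_trans (leq_subr _ _) _.
rewrite (big_ltn (m := M.+1)) ?ltnS // -!addnA; congr (_ + _).
rewrite addnCA subnKC ?leq_removal_weight // addnC; congr (_ + _).
rewrite -big_split /=; apply: eq_bigr => N _.
by rewrite subnKC // leq_removal_weight.
Qed.

Lemma loss_mono (i j : nat) : i <= j -> loss j <= loss i.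
Proof.
move=> ij; rewrite /loss /removal_weight.
have lei q m: m <= q.-1 -> forall x : H, true ->
    m ^_ degree x * (q - 1 - degree x) ^_ (#|H| - 1 - degree x) <=
    q.-1 ^_ degree x * (q - 1 - degree x) ^_ (#|H| - 1 - degree x).
  by move=> mq x _; rewrite leq_mul2r leq_ffact2r ?orbT.
(* Beyond this range [loss j] is a truncated difference, equal to 0. *)
have [jp|] := leqP j.+1 (p - j).-1; last first.
  by move/ltnW=> pj; have/eqP-> : removal_weight H (p - j) (p - j).-1
    - removal_weight H (p - j) j.+1 == 0 by rewrite subn_eq0 leq_removal_weight.
have pij : p - j <= p - i by apply: leq_sub2l.
have ip : i.+1 <= (p - i).-1.
  by apply: leq_trans (leq_trans jp _); rewrite ?ltnS // -!subn1 leq_sub2r.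
rewrite -!sumnB; try by apply: lei.
apply: leq_sum => x _; rewrite -!mulnBl leq_mul //; last first.
  by rewrite leq_ffact2r // !leq_sub2r.
by apply: leq_sub; rewrite leq_ffact2r // -!subn1 leq_sub2r.
Qed.

(** A larger [j] gives more summands, and each is larger because falling factorials have
    nondecreasing differences. *)
Lemma gain_mono (i j : nat) : i <= j -> gain i <= gain j.
Proof.
move=> ij; rewrite /gain.
have pij : p - j <= p - i by apply: leq_sub2l.
have [pin|nip] := leqP (p - i).+1 n.+1; last first.
  by rewrite big_geq // ltnW.
rewrite [leqRHS](@big_cat_nat _ _ _ (p - i).+1) //=; apply: leq_trans (leq_addl _ _).
apply: leq_sum => N _; rewrite /removal_weight.
rewrite -!sumnB; try by move=> x _; rewrite leq_mul2r leq_ffact2r ?orbT.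
by apply: leq_sum => x _; rewrite -!mulnBl leq_mul2r ffact_diff_leq ?orbT.
Qed.

Lemma removal_bound_convex (k j t : nat) :
  p <= n -> k <= j <= t -> t.*2 < p -> phi j <= maxn (phi k) (phi t).
Proof.
move=> pn /andP[kj jt] tp; rewrite leq_max.
have step i : i < t -> phi i.+1 + loss i = phi i + gain i.
  move=> it; apply: removal_bound_step => //.
  by apply: leq_trans (ltnW tp); rewrite -doubleS leq_double.
(* The sign of the difference at [j] decides: if nonnegative, it stays so and [phi] does not
   decrease up to [t]; if negative, it was so before and [phi] decreases from [k] to [j]. *)
have [lg|gl] := leqP (loss j) (gain j); apply/orP; [right|left].
  have up d : j + d <= t -> phi j <= phi (j + d).
    elim: d => [|d IH]; rewrite ?addn0 // addnS => jdt.
    apply: leq_trans (IH (ltnW jdt)) _.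
    rewrite -(leq_add2r (loss (j + d))) step // leq_add2l.
    apply: leq_trans (loss_mono (leq_addr _ _)) (leq_trans lg _).
    exact/gain_mono/leq_addr.
  by rewrite -(subnKC jt) up // subnKC.
have down d : d <= j - k -> phi j <= phi (j - d).
  elim: d => [|d IH]; rewrite ?subn0 // => djk.
  apply: leq_trans (IH (ltnW djk)) _.
  have dj : d < j by apply: leq_trans djk (leq_subr _ _).
  rewrite subnS; have: 0 < j - d by rewrite subn_gt0.
  have: j - d <= j by apply: leq_subr.
  case: (j - d) => // i ij _ /=.
  rewrite -(leq_add2r (gain i)) -step ?(leq_trans ij) // leq_add2l.
  apply: leq_trans (gain_mono (ltnW ij)) (leq_trans (ltnW gl) _).
  exact/loss_mono/ltnW.
by rewrite -(subKn kj) down.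
Qed.

End Fixed.
End Convexity.

(** * Paths and cycles *)

Section SymmetricPaths.
Variables (T : eqType) (e : rel T).
Hypothesis eS : symmetric e.

Lemma split_last_has (P : pred T) (s : seq T) :
  has P s -> exists s1 y s2, [/\ s = s1 ++ y :: s2, P y & ~~ has P s2].
Proof.
elim: s => //= x s IH; have [/IH[s1 [y [s2 [-> Py Ns2]]]] _|Ns] := boolP (has P s).
  by exists (x :: s1), y, s2.
by rewrite orbF => Px; exists [::], x, s.
Qed.

(** Cut at the last vertex in [A], then at the first vertex in [B] after it. *)
Lemma path_bridge (A B : pred T) (x : T) (s : seq T) :
    path e x s -> uniq (x :: s) -> A x -> B (last x s) ->
    (forall y, A y -> ~~ B y) ->
  exists y s' z, [/\ A y, B z, path e y (rcons s' z), uniq s' &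
                     {in s', forall t, ~~ A t && ~~ B t}].
Proof.
move=> xs U Ax Bl AB.
have [|s1 [y [s2 [E Ay Ns2]]]] := @split_last_has A (x :: s); first by rewrite /= Ax.
have [ys2 lE] : path e y s2 /\ last y s2 = last x s.
  case: s1 E xs => [[-> ->] //|z s1 [-> ->]].
  by rewrite cat_path last_cat /= => /and3P[].
have Us2 : uniq s2 by move: U; rewrite E cat_uniq /= => /and3P[_ _ /andP[]].
have BS : has B s2.
  apply/hasP; exists (last y s2); last by rewrite lE.
  have := mem_last y s2; rewrite inE => /predU1P[ly|//].
  by move: Bl; rewrite -lE ly (negPf (AB _ Ay)).
case: (split_find BS) Us2 Ns2 ys2 => z s3 s4 Bz Ns3.
rewrite cat_uniq rcons_uniq has_cat has_rcons cat_path !negb_or.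
case/and3P=> /andP[_ Us3] _ _ /andP[/andP[_ As3] _] /andP[ys3 _].
exists y, s3, z; split=> // t ts3.
by rewrite (hasPn As3 _ ts3) (hasPn Ns3 _ ts3).
Qed.

Lemma cycle_cat_rev (x y : T) (s1 s2 : seq T) :
    path e x s1 -> path e y s2 -> e (last x s1) (last y s2) -> e y x ->
  cycle e ((x :: s1) ++ rev (y :: s2)).
Proof.
move=> xs1 ys2 ll yx; rewrite /= rcons_cat cat_path xs1 /=.
set l := last x s1.
have -> : rcons (rev (y :: s2)) x = rev (belast x (rcons (y :: s2) l)).
  by rewrite belast_rcons [in RHS]rev_cons.
have {1}-> : l = last x (rcons (y :: s2) l) by rewrite last_rcons.
rewrite rev_path (@eq_path _ _ e) => [|u v]; last by rewrite eS.
by rewrite /= eS yx rcons_path ys2 eS.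
Qed.

(** The path is closed at its last vertex in [A]. The cycle may have two vertices, a single edge run
    in both directions. *)
Lemma cycle_from (A : pred T) (x : T) (s : seq T) :
    path e x s -> uniq (x :: s) -> has A s -> {in A, forall y, e x y} ->
  exists c, [/\ cycle e c, uniq c, {subset c <= x :: s}, x \in c &
                {in s, forall y, A y -> y \in c}].
Proof.
move=> xs U hA Ax; have [s1 [y [s2 [E Ay Ns2]]]] := split_last_has hA.
exists (x :: rcons s1 y); move: xs U; rewrite E -cat_rcons => xs U; split.
- move: xs; rewrite cat_path => /andP[xs1 _].
  by rewrite /= rcons_path xs1 last_rcons eS Ax.
- by move: U; rewrite -cat_cons cat_uniq => /andP[].
- by move=> z; rewrite !inE mem_cat => /predU1P[->|->]; rewrite ?eqxx ?orbT.
- exact: mem_head.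
move=> z; rewrite mem_cat inE => /orP[->|zs2 Az]; first by rewrite orbT.
by case/negP: (hasPn Ns2 z zs2).
Qed.

(** Run around all of [c1], ending where a bridge leaves it, cross the bridge, then run around all
    of [c2]. *)
Lemma disjoint_cycles_path (c1 c2 : seq T) (x y : T) (s : seq T) :
    cycle e c1 -> cycle e c2 -> uniq c1 -> uniq c2 ->
    {in c1, forall z, z \notin c2} ->
    x \in c1 -> y \in c2 -> path e x s -> last x s = y ->
  exists q, [/\ q != [::], sorted e q, uniq q & size c1 + size c2 <= size q].
Proof.
move=> C1 C2 U1 U2 C12 xc1 yc2 xs ly.
case/shortenP: xs ly => s0 xs0 Us0 _ ly.
have lc2 : last x s0 \in c2 by rewrite ly.
have [y1 [t [z1 [y1c z1c P Ut At]]]] := path_bridge xs0 Us0 xc1 lc2 C12.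
have [i1 d1 E1] := rot_to y1c; have [i2 d2 E2] := rot_to z1c.
have perm1 : perm_eq (rcons d1 y1) c1.
  by rewrite perm_sym -(perm_rot i1) E1 perm_sym perm_rcons.
have perm2 : perm_eq (z1 :: d2) c2 by rewrite -E2 perm_rot.
have P1 : path e y1 (rcons d1 y1) by move: C1; rewrite -(rot_cycle i1) E1.
have P2 : path e z1 d2.
  by move: C2; rewrite -(rot_cycle i2) E2 /= rcons_path => /andP[].
exists (rcons d1 y1 ++ t ++ z1 :: d2); split.
- by case: (d1).
- apply: (@path_sorted _ _ y1); rewrite cat_path P1 last_rcons /=.
  by rewrite -cat_rcons cat_path P last_rcons.
- rewrite cat_uniq (perm_uniq perm1) U1 cat_uniq Ut (perm_uniq perm2) U2 !(andTb, andbT).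
  apply/andP; split; apply/hasPn=> v; rewrite ?mem_cat (perm_mem perm2).
    rewrite (perm_mem perm1) => /orP[/At/andP[]|vc2] //.
    by apply: contraL vc2; apply: C12.
  by move=> vc2; apply: contraL vc2 => /At/andP[].
- by rewrite !size_cat (perm_size perm1) (perm_size perm2) leq_add2l leq_addl.
Qed.

End SymmetricPaths.

(** * Joining a vertex to the graph, and Posa's rotation *)

Section Apex.
Variable G : sgraph.

(* The join of G with one new vertex, [None]. *)
Definition apex_adj : rel (option G) := fun u v =>
  match u, v with
  | Some x, Some y => adj x y
  | None, None => false
  | _, _ => true
  end.

Lemma apex_adj_sym : symmetric apex_adj.
Proof. by move=> [x|] [y|] //=; apply: adj_sym. Qed.

Lemma is_pathE (q : seq G) : is_path q = [&& q != [::], sorted adj q & uniq q].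
Proof. by case: q. Qed.

Lemma map_Some_pmap (S : eqType) (s : seq (option S)) :
  None \notin s -> map Some (pmap id s) = s.
Proof. by elim: s => //= -[x|] s IH //; rewrite inE => /= /IH->. Qed.

Lemma path_map_Some (x : G) (s : seq G) :
  path apex_adj (Some x) (map Some s) = path adj x s.
Proof. by rewrite path_map; apply: eq_path. Qed.

Lemma sorted_map_Some (s : seq G) : sorted apex_adj (map Some s) = sorted adj s.
Proof. by case: s => //= x s; apply: path_map_Some. Qed.

Lemma cycle_through_neighbours (x : G) (q : seq G) (X : {set G}) :
    path adj x q -> uniq (x :: q) -> 0 < #|X| ->
    {in X, forall y, adj x y} -> {in X, forall y, y \in x :: q} ->
  exists c, [/\ cycle adj c, uniq c, {subset c <= x :: q}, x \in c & #|X| < size c].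
Proof.
move=> xq U X0 Xx Xq.
have {}Xq : {in X, forall y, y \in q}.
  move=> y yX; have := Xq y yX; rewrite inE => /predU1P[yx|//].
  by have := Xx y yX; rewrite yx adj_irr.
have hX : has (mem X) q.
  by have [y yX] := card_gt0P X0; apply/hasP; exists y; rewrite ?Xq.
have [c [C Uc cq xc Xc]] := cycle_from (@adj_sym G) xq U hX Xx.
exists c; split=> //; rewrite cardE -/(size (x :: enum X)).
apply: uniq_leq_size => [|y].
  by rewrite /= enum_uniq mem_enum andbT; apply/negP=> /Xx; rewrite adj_irr.
by rewrite inE mem_enum => /predU1P[->|yX] //; apply: Xc => //; apply: Xq.
Qed.

Variable p : nat.
Hypothesis short : forall q : seq G, is_path q -> size q <= p.

Lemma apex_path_None (s : seq (option G)) :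
  sorted apex_adj s -> uniq s -> p < size s -> None \in s.
Proof.
move=> sp U ps; apply: contraLR ps => /map_Some_pmap sE; rewrite -leqNgt.
case: s => // o s in sp U sE *.
rewrite -sE size_map short // is_pathE -sorted_map_Some sE sp.
rewrite -(map_inj_uniq Some_inj) sE U !andbT.
by case: (pmap id _) sE => //.
Qed.

(** A longer cycle would pass through the apex, and deleting the apex would leave a path of [G] on
    more than [p] vertices. *)
Lemma apex_cycle (c : seq (option G)) : cycle apex_adj c -> uniq c -> size c <= p.+1.
Proof.
move=> C U; rewrite leqNgt; apply/negP=> pc.
have Nc : None \in c.
  apply: apex_path_None; rewrite ?(ltnW pc) //.
  by case: c C {U pc} => //= o c; rewrite rcons_path => /andP[].
have [i c' E] := rot_to Nc.
move: C U pc; rewrite -(rot_cycle i) -(rot_uniq i) -(size_rot i) E /=.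
rewrite rcons_path ltnS => /andP[/path_sorted C _] /andP[Nc' U] /(apex_path_None C U).
by rewrite (negPf Nc').
Qed.

Hypothesis conn : forall x y : G, connect adj x y.

Lemma disjoint_cycles_size (c1 c2 : seq G) (x y : G) :
    cycle adj c1 -> cycle adj c2 -> uniq c1 -> uniq c2 ->
    {in c1, forall z, z \notin c2} -> x \in c1 -> y \in c2 ->
  size c1 + size c2 <= p.
Proof.
move=> C1 C2 U1 U2 C12 xc1 yc2; have /connectP[s xs ys] := conn x y.
have [q [q0 qs qU qc]] := disjoint_cycles_path C1 C2 U1 U2 C12 xc1 yc2 xs (esym ys).
by apply: leq_trans qc _; rewrite short // is_pathE q0 qs.
Qed.

Section Posa.
Variables (u w : G) (s : seq (option G)) (A B : {set G}).
Let Q := Some u :: s.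
Hypotheses (us : path apex_adj (Some u) s) (Us : uniq Q) (sw : last (Some u) s = Some w).
Hypotheses (uA : {in A, forall y, adj u y}) (wB : {in B, forall y, adj w y}).
Hypotheses (AQ : {in A, forall y, Some y \in Q}) (BQ : {in B, forall y, Some y \in Q}).

(** The apex is adjacent to all vertices, so it counts as a neighbour of both ends. *)
Let nbr (X : {set G}) (o : option G) := if o is Some y then y \in X else true.
Let nbr_at (X : {set G}) i := nbr X (nth None Q i).

Lemma sum_nbr (X : {set G}) : None \in Q -> {in X, forall y, Some y \in Q} ->
  #|X|.+1 <= \sum_(0 <= i < size Q) nbr_at X i.
Proof.
move=> NQ XQ; have -> : \sum_(0 <= i < size Q) nbr_at X i = count (nbr X) Q.
  rewrite -sum1_count (big_nth None) [RHS]big_mkcond /=.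
  by apply: eq_bigr => i _; rewrite /nbr_at; case: ifP.
rewrite -size_filter cardE -(size_map Some) -/(size (None :: map Some (enum X))).
apply: uniq_leq_size.
  rewrite /= map_inj_uniq ?enum_uniq ?andbT; last exact: Some_inj.
  by apply/mapP=> -[].
move=> o; rewrite inE mem_filter => /predU1P[->|/mapP[y]]; first by rewrite NQ.
by rewrite mem_enum => yX ->; rewrite XQ //= yX.
Qed.

(* A neighbour of w preceding a neighbour of u on the path closes a cycle
   that skips only the vertices strictly between the two. With the shortest such
   gap no neighbour is skipped. *)
Lemma crossing_bound (i d : nat) :
    None \in Q -> i + d.+1 < size Q -> nbr_at B i -> nbr_at A (i + d.+1) ->
  p.+1 < size Q -> #|A| + #|B| < p.
Proof.
move=> NQ; pose P d := [exists i : 'I_(size Q),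
  [&& i + d.+1 < size Q, nbr_at B i & nbr_at A (i + d.+1)]].
move=> idQ Bi Ad pQ.
have exP : exists d, P d.
  exists d; apply/existsP; have iQ : i < size Q by apply: leq_ltn_trans idQ; rewrite leq_addr.
  by exists (Ordinal iQ); rewrite idQ Bi.
case: (ex_minnP exP) => {idQ Bi Ad}d /existsP[[{}i iQ] /= /and3P[idQ Bi Ad]] dmin.
have gap (a b : nat) : a < b -> b < size Q -> nbr_at B a -> nbr_at A b -> a + d < b.
  move=> ab bQ Ba Ab; have aQ := ltn_trans ab bQ.
  have bE : a + (b - a.+1).+1 = b by rewrite addnS -addSn subnKC.
  have : d <= b - a.+1.
    by apply: dmin; apply/existsP; exists (Ordinal aQ); rewrite /= bE bQ Ba.
  by rewrite leq_subRL // addSn.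
have dropE : drop (i + d.+1) Q = nth None Q (i + d.+1) :: drop (i + d.+1).+1 Q.
  by apply: drop_nth.
have cyc : cycle apex_adj (take i.+1 Q ++ rev (drop (i + d.+1) Q)).
  have takeE : take i.+1 Q = Some u :: take i s by [].
  rewrite takeE dropE; apply: cycle_cat_rev; first exact: apex_adj_sym.
  - exact: take_path.
  - have := us; rewrite -[s](cat_take_drop (i + d)) cat_path => /andP[_].
    by have := dropE; rewrite addnS /= => -> /= /andP[].
  - have -> : last (nth None Q (i + d.+1)) (drop (i + d.+1).+1 Q) = Some w.
      have: last (Some u) Q = Some w by [].
      rewrite -{1}(cat_take_drop (i + d.+1) Q) dropE last_cat /= => <-.
      by [].
    have -> : last (Some u) (take i s) = nth None Q i.
      have -> : last (Some u) (take i s) = last (Some u) (take i.+1 Q) by [].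
      rewrite (take_nth None) //; exact: last_rcons.
    by move: Bi; rewrite /nbr_at /nbr; case: (nth None Q i) => //= y /wB; rewrite adj_sym.
  - by move: Ad; rewrite /nbr_at /nbr; case: (nth None Q _) => //= y /uA; rewrite adj_sym.
have cycU : uniq (take i.+1 Q ++ rev (drop (i + d.+1) Q)).
  rewrite (perm_uniq (perm_cat (perm_refl _) (permEl (perm_rev _)))).
  apply: subseq_uniq Us; rewrite -[X in subseq _ X](cat_take_drop (i + d.+1)).
  apply: cat_subseq => //; rewrite -(@take_takel _ i.+1 (i + d.+1)) ?take_subseq //.
  by rewrite addnS ltnS leq_addr.
(* The cycle has [size Q - d] vertices, so the bound [p.+1] forces [d > 0]. *)
have := apex_cycle cyc cycU.
rewrite size_cat size_rev size_drop size_takel // => sz.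
have d0 : 0 < d.
  rewrite lt0n; apply/eqP=> d0; move: sz pQ; rewrite d0 addn1 subnKC // => sz.
  by rewrite ltnNge sz.
have lastE : nth None Q (size s) = Some w := etrans (nth_last None Q) sw.
have mE : size Q = (size s).+1 by [].
move: (size s) mE lastE => m mE lastE.
(* Position 0 is [u], which is not its own neighbour, so indices may be shifted by one; likewise the
   last position [w] is dropped for [B]. The extra one on the left is the apex. *)
have sA : #|A|.+1 <= \sum_(0 <= l < m) nbr_at A l.+1.
  have := sum_nbr NQ AQ; rewrite mE big_nat_recl //= {1}/nbr_at /=.
  by case: (boolP (u \in A)) => // /uA; rewrite adj_irr.
have sB : #|B|.+1 <= \sum_(0 <= l < m) nbr_at B l.
  have := sum_nbr NQ BQ; rewrite mE big_nat_recr //= {2}/nbr_at lastE /=.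
  by case: (boolP (w \in B)) => [/wB|]; rewrite ?adj_irr // addn0.
have idm : i + d < m by rewrite -ltnS -addnS -mE.
have sI : d.-1 <= \sum_(0 <= l < m) (i < l < i + d).
  rewrite (@big_cat_nat _ _ _ i.+1) //=; last exact: leq_ltn_trans (leq_addr d i) idm.
  rewrite (@big_cat_nat _ _ _ (i + d) i.+1) /=; last 2 first.
  - by rewrite -addn1 leq_add2l.
  - exact: ltnW.
  rewrite [X in _ + (X + _)](_ : _ = d.-1); first by rewrite addnCA leq_addr.
  rewrite big_nat_cond (eq_bigr (fun=> 1)); last by move=> l /andP[->].
  by rewrite -big_nat_cond sum_nat_const_nat muln1 subnS addKn.
(* Any two of the three events at the same [l] would give a crossing with a gap smaller than [d]. *)
have tot : \sum_(0 <= l < m) (nbr_at A l.+1 + nbr_at B l + (i < l < i + d)) <= m.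
  rewrite -[leqRHS]subn0 -[leqRHS]muln1 -sum_nat_const_nat.
  rewrite big_nat_cond [leqRHS]big_nat_cond; apply: leq_sum => l /andP[/andP[_ lm] _].
  have l1Q : l.+1 < size Q by rewrite mE.
  have lQ := ltnW l1Q.
  have [Al|_] := boolP (nbr_at A l.+1); have [Bl|_] := boolP (nbr_at B l) => //=.
  - by have := gap l l.+1 (ltnSn l) l1Q Bl Al; rewrite -[l.+1]addn1 ltn_add2l; case: (d) d0.
  - case: andP => // -[il ld].
    have := gap i l.+1 (ltnW il) l1Q Bi Al; rewrite ltnS leqNgt ld.
    by [].
  - case: andP => // -[il ld]; have lj : l < i + d.+1 by rewrite addnS ltnW.
    have := gap l (i + d.+1) lj idQ Bl Ad.
    by rewrite addnS ltnS leq_add2r leqNgt il.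
  by case: (_ < _ < _).
rewrite !big_split /= in tot.
have := leq_trans (leq_add (leq_add sA sB) sI) tot.
move: sz idm d0; rewrite mE; lia.
Qed.

(* Without crossing neighbours the apex separates those of u from those of w, and
   each end of the path carries a cycle of G through all of its neighbours. *)
Lemma posa : 0 < #|A| -> 0 < #|B| -> p.+1 < size Q -> #|A| + #|B| < p.
Proof.
move=> A0 B0 pQ.
have NQ : None \in Q by apply: apex_path_None; rewrite ?(ltnW pQ).
have [/existsP[i /existsP[d /and3P[idQ Bi Aj]]]|] := boolP
    [exists i : 'I_(size Q), exists d : 'I_(size Q),
       [&& i + d.+1 < size Q, nbr_at B i & nbr_at A (i + d.+1)]].
  exact: crossing_bound NQ idQ Bi Aj pQ.
move=> /existsPn ncross.
have nocross i j : i < j -> j < size Q -> nbr_at B i -> nbr_at A j -> False.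
  move=> ij jQ Bi Aj; have iQ := ltn_trans ij jQ.
  have dQ : j - i.+1 < size Q by apply: leq_ltn_trans (leq_subr _ _) jQ.
  have /existsPn/(_ (Ordinal dQ))/negP[] := ncross (Ordinal iQ).
  by rewrite /= addnS -addSn subnKC // jQ Bi.
have [s1 [s2 [QE N1 N2]]] : exists s1 s2,
    [/\ Q = s1 ++ None :: s2, None \notin s1 & None \notin s2].
  case: (splitPr NQ) Us => s1 s2; rewrite cat_uniq /= negb_or.
  by case/and4P=> _ /andP[? _] ? _; exists s1, s2.
pose q1 := pmap id s1; pose q2 := pmap id s2.
have q1E : map Some q1 = s1 by apply: map_Some_pmap.
have q2E : map Some q2 = s2 by apply: map_Some_pmap.
(* The apex stands at position [size s1] and counts for both ends, so without crossings [A] lies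
   before it and [B] after it. *)
have atz X : nbr_at X (size s1) by rewrite /nbr_at QE nth_cat ltnn subnn.
have zQ : size s1 < size Q by rewrite QE size_cat /= addnS ltnS leq_addr.
have at_index (X : {set G}) y : y \in X -> Some y \in Q -> nbr_at X (index (Some y) Q).
  by move=> yX yQ; rewrite /nbr_at nth_index.
have A1 : {in A, forall y, y \in q1}.
  move=> y yA; have yQ := AQ yA; apply: contraT => yq1.
  have ys1 : Some y \notin s1 by rewrite -q1E mem_map //; apply: Some_inj.
  case: (@nocross (size s1) (index (Some y) Q)); rewrite ?index_mem ?at_index //.
  by rewrite QE index_cat (negPf ys1) /= addnS ltnS leq_addr.
have B2 : {in B, forall y, y \in q2}.
  move=> y yB; have yQ := BQ yB.
  have ys1 : Some y \notin s1.
    apply/negP=> ys1; case: (@nocross (index (Some y) Q) (size s1)); rewrite ?at_index //.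
    by rewrite QE index_cat ys1 index_mem.
  move: yQ; rewrite QE mem_cat (negPf ys1) inE /= -q2E mem_map //.
  exact: Some_inj.
have uq2 : uniq q2 /\ uniq q1 /\ {in q1, forall y, y \notin q2}.
  move: Us; rewrite QE -q1E -q2E cat_uniq cons_uniq !(map_inj_uniq Some_inj).
  case/and4P=> U1 /hasPn H _ U2; split=> //; split=> // y yq1.
  apply/negP=> yq2; have := H (Some y); rewrite inE !(mem_map Some_inj) yq2 orbT.
  by rewrite yq1 => /(_ isT).
have [U2 [U1 U12]] := uq2.
have [S1 S2] : sorted apex_adj s1 /\ sorted apex_adj s2.
  have: sorted apex_adj Q by [].
  by rewrite QE => /cat_sorted2[-> /path_sorted->].
rewrite -q1E sorted_map_Some in S1; rewrite -q2E sorted_map_Some in S2.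
have [t1 E1] : exists t1, q1 = u :: t1.
  by rewrite /q1; move: QE; case: (s1) => [|o l] // [<- _] /=; exists (pmap id l).
have [t2 E2] : exists t2, rev q2 = w :: t2.
  have: last (Some u) Q = Some w by [].
  rewrite QE last_cat /= -q2E; case/lastP: (q2) => //= t2 y.
  by rewrite map_rcons last_rcons rev_rcons => -[->]; exists (rev t2).
have [|||||c1 [C1 Uc1 cq1 uc1 sc1]] := @cycle_through_neighbours u t1 A; rewrite -?E1 //.
  by move: S1; rewrite E1.
have [|||||c2 [C2 Uc2 cq2 wc2 sc2]] := @cycle_through_neighbours w t2 B;
    rewrite -?E2 ?rev_uniq //.
- have: sorted adj (rev q2).
    by rewrite rev_sorted (eq_sorted (e' := adj)) // => x y; rewrite adj_sym.
  by rewrite E2.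
- by move=> y yB; rewrite mem_rev B2.
have C12 : {in c1, forall z, z \notin c2}.
  move=> z /cq1; rewrite -E1 => zq1; apply/negP=> /cq2; rewrite -E2 mem_rev.
  exact/negP/U12.
have := disjoint_cycles_size C1 C2 Uc1 Uc2 C12 uc1 wc2.
by apply: leq_trans; rewrite -addnS leq_add // ltnW.
Qed.

End Posa.
End Apex.

(** * Edge-maximal supergraphs *)

Lemma sorted_defect (T : eqType) (e1 e2 : rel T) (q : seq T) :
    sorted e1 q -> ~~ sorted e2 q ->
  exists q1 x y q2, [/\ q = q1 ++ x :: y :: q2, e1 x y & ~~ e2 x y].
Proof.
case: q => // x q /=; elim: q x => //= y q IH x /andP[xy yq].
have [xy2 /= Nyq|Nxy _] := boolP (e2 x y); last by exists [::], x, y, q.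
by have [q1 [a [b [q2 [-> ab Nab]]]]] := IH y yq Nyq; exists (x :: q1), a, b, q2.
Qed.

Section Saturation.
Variables (G : sgraph) (p : nat).

(** Edges are a set of ordered pairs, so that an inclusion-maximal one can be taken. Excluding paths
    on exactly [p.+1] vertices suffices, since a longer path has such an initial segment. *)
Let bounded (E : {set G * G}) :=
  [&& [forall x, (x, x) \notin E],
      [forall x, forall y, ((x, y) \in E) ==> ((y, x) \in E)] &
      [forall q : p.+1.-tuple G, ~~ (sorted [rel x y | (x, y) \in E] q && uniq q)]].

(** In an edge-maximal supergraph, adding [uv] creates a path on [p.+1] vertices that uses [uv].
    Deleting [uv] leaves two paths starting at [u] and [v]; linking their far ends through the apex
    gives a path from [u] to [v] on [p + 2] vertices. *)
Lemma saturated_supergraph :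
    (forall q : seq G, is_path q -> size q <= p) ->
  exists (e : rel G) (eS : symmetric e) (eI : irreflexive e),
    let G' := SGraph eS eI in
    [/\ subrel adj e, forall q : seq G', is_path q -> size q <= p &
        forall u v : G', u != v -> ~~ adj u v ->
        exists s, [/\ path (@apex_adj G') (Some u) s, uniq (Some u :: s),
                      last (Some u) s = Some v & p < size s]].
Proof.
move=> short; pose E0 := [set u : G * G | adj u.1 u.2].
have bE0 : bounded E0.
  apply/and3P; split.
  - by apply/forallP=> x; rewrite inE /= adj_irr.
  - by apply/forallP=> x; apply/forallP=> y; rewrite !inE /= adj_sym implybb.
  apply/forallP=> q; apply/negP=> /andP[qs qU].
  have: is_path q.
    rewrite is_pathE qU andbT -size_eq0 size_tuple /=.
    by rewrite (@eq_sorted _ _ [rel x y | (x, y) \in E0]) // => x y; rewrite /= inE.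
  by move/short; rewrite size_tuple ltnn.
have [E /maxsetP[/and3P[/forallP EI /forallP ES /forallP Ep] Emax] E0E] := maxset_exists bE0.
pose e := [rel x y | (x, y) \in E].
have eS : symmetric e.
  move=> x y; apply/idP/idP; [have := ES x|have := ES y].
    by move/forallP/(_ y)/implyP; apply.
  by move/forallP/(_ x)/implyP; apply.
have eI : irreflexive e by move=> x; apply/negbTE/EI.
have eshort q : sorted e q -> uniq q -> size q <= p.
  move=> qs qU; rewrite leqNgt; apply/negP=> pq.
  have tq : size (take p.+1 q) == p.+1 by rewrite size_takel.
  by have /negP[] := Ep (Tuple tq); rewrite /= take_sorted ?take_uniq.
exists e, eS, eI; split.
- by move=> x y xy; apply: (subsetP E0E); rewrite inE.
- by move=> q; rewrite is_pathE => /and3P[_]; apply: eshort.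
move=> u v uv Nuv; pose F := (u, v) |: ((v, u) |: E).
have NF : ~~ bounded F.
  apply/negP=> /Emax FE; case/negP: Nuv; rewrite -[adj u v]/((u, v) \in E) -FE ?setU11 //.
  by apply: subset_trans (subsetUr _ _); apply: subsetUr.
have [q [qs qU qz]] : exists q, [/\ sorted [rel x y | (x, y) \in F] q, uniq q & size q = p.+1].
  have [/existsP[q /andP[qs qU]]|Nq] := boolP
    [exists q : p.+1.-tuple G, sorted [rel x y | (x, y) \in F] q && uniq q].
    by exists q; rewrite size_tuple.
  case/negP: NF; apply/and3P; split; last by rewrite -negb_exists.
  - apply/forallP=> x; rewrite !inE !xpair_eqE (negPf (EI x)) orbF negb_or.
    by apply/andP; split; apply: contra uv => /andP[/eqP<- /eqP<-].
  - apply/forallP=> x; apply/forallP=> y; apply/implyP; rewrite !inE !xpair_eqE.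
    rewrite (eS y x : ((y, x) \in E) = ((x, y) \in E)) => /or3P[/andP[-> ->]|/andP[-> ->]|->];
    by rewrite ?orbT.
have NeF x y : (x, y) \in F -> ~~ e x y -> x = u /\ y = v \/ x = v /\ y = u.
  rewrite !inE !xpair_eqE => /or3P[/andP[/eqP-> /eqP->]|/andP[/eqP-> /eqP->]|]; auto.
  by rewrite /e /= => ->.
have [|q1 [x [y [q2 [qE xyF Nxy]]]]] := @sorted_defect _ _ e q qs.
  by apply/negP=> /eshort/(_ qU); rewrite qz ltnn.
(* A piece of the path that misses [u] or misses [v] cannot use the new edge. *)
have sub z : z = u \/ z = v -> {in predC1 z &, subrel [rel x y | (x, y) \in F] e}.
  move=> zuv a b; rewrite !inE => az bz abF; apply: contraT => /(NeF _ _ abF) H.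
  by move: az bz; case: H => -[-> ->]; case: zuv => ->; rewrite eqxx.
have xyuv := NeF x y xyF Nxy.
rewrite qE -cat_rcons in qs qU; have [s1 s2] := cat_sorted2 qs.
move: qU; rewrite cat_uniq => /and3P[U1 /hasPn U12 U2].
have e1 : sorted e (rcons q1 x).
  apply: (sub_in_sorted (sub y _)) s1; first by case: xyuv => -[_ ->]; auto.
  apply/allP=> z zq /=; apply: contraTneq zq => ->.
  by apply: U12; rewrite mem_head.
have e2 : sorted e (y :: q2).
  apply: (sub_in_sorted (sub x _)) s2; first by case: xyuv => -[-> _]; auto.
  apply/allP=> z zq /=; apply: contraTneq zq => ->.
  by apply/negP=> /U12; rewrite mem_rcons mem_head.
have e1r : sorted e (x :: rev q1).
  by rewrite -rev_rcons rev_sorted (eq_sorted (e' := e)) // => a b; rewrite eS.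
have [r1 [r2 [ur1 vr2 Ur sr]]] : exists r1 r2, [/\ path e u r1, path e v r2,
    uniq ((u :: r1) ++ v :: r2) & size r1 + size r2 = p.-1].
  have sz : size q1 + size q2 = p.-1.
    by move: qz; rewrite qE size_cat /= !addnS => -[<-].
  have Uq : uniq ((x :: rev q1) ++ y :: q2).
    by rewrite -rev_rcons cat_uniq rev_uniq U1 U2 andbT; apply/hasPn=> z /U12; rewrite mem_rev.
  case: xyuv => -[xE yE].
    by exists (rev q1), q2; rewrite size_rev -xE -yE; split.
  exists q2, (rev q1); rewrite size_rev -xE -yE; split=> //; last by rewrite addnC.
  by rewrite uniq_catC.
have p0 : 0 < p by move: qz; rewrite qE size_cat /= !addnS => -[<-].
exists (map Some r1 ++ None :: map Some (rev (v :: r2))); split.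
- rewrite cat_path path_map_Some ur1 last_map.
  have: sorted (@adj (SGraph eS eI)) (rev (v :: r2)).
    by rewrite rev_sorted (eq_sorted (e' := e)) // => a b; rewrite /= eS.
  by case: (rev (v :: r2)) => //= a r ar; rewrite (@path_map_Some (SGraph eS eI)).
- rewrite -cat_cons -map_cons (uniq_catCA _ [:: None]) -map_cat cons_uniq.
  apply/andP; split; first by apply/mapP=> -[].
  rewrite map_inj_uniq; last exact: Some_inj.
  by rewrite (perm_uniq (perm_cat (perm_refl _) (permEl (perm_rev _)))).
- by rewrite last_cat rev_cons map_rcons /= last_rcons.
- by rewrite size_cat /= !size_map size_rev /= !addnS sr prednK.
Qed.
End Saturation.

(** * Kopylov's argument *)

Section Core.
Variables (G : sgraph) (p : nat).
Hypothesis short : forall q : seq G, is_path q -> size q <= p.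
Hypothesis conn : forall x y : G, connect adj x y.
Hypothesis saturated : forall u v : G, u != v -> ~~ adj u v ->
  exists s, [/\ path (@apex_adj G) (Some u) s, uniq (Some u :: s),
                last (Some u) s = Some v & p < size s].

(** Among the nonadjacent pairs from [U] and [W], take one with a longest path between its members
    in the join. All neighbours of [u] in [U] and of [w] in [W] then lie on this path, and [posa]
    contradicts [p <= a + b]. *)
Lemma dense_sets_joined (U W : {set G}) (a b : nat) :
    0 < a -> 0 < b -> p <= a + b ->
    {in U, forall x, a <= #|[set y in U | adj x y]|} ->
    {in W, forall x, b <= #|[set y in W | adj x y]|} ->
  {in U & W, forall u w, u != w -> adj u w}.
Proof.
move=> a0 b0 pab Ua Wb u0 w0 u0U w0W uw0; apply: contraT => Nuw0.
pose P m := [exists u in U, exists w in W, exists s : m.-tuple (option G),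
  [&& u != w, ~~ adj u w, path (@apex_adj G) (Some u) s, uniq (Some u :: s)
    & last (Some u) s == Some w]].
have PI (u w : G) s : u \in U -> w \in W -> u != w -> ~~ adj u w ->
    path (@apex_adj G) (Some u) s -> uniq (Some u :: s) ->
    last (Some u) s = Some w -> P (size s).
  move=> uU wW uw Nuw us Us sw; apply/exists_inP; exists u => //.
  apply/exists_inP; exists w => //; apply/existsP; exists (in_tuple s).
  by rewrite uw Nuw us Us sw eqxx.
have [s0 [us0 Us0 sw0 ps0]] := saturated uw0 Nuw0.
have P0 : P (size s0) by apply: PI us0 Us0 sw0.
have ubP m : P m -> m <= #|{: option G}|.
  case/exists_inP=> u _ /exists_inP[w _ /existsP[s /and5P[_ _ _ Us _]]].
  by apply: leq_trans (max_card (mem (Some u :: s))); rewrite (card_uniqP Us) /= size_tuple.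
case: (ex_maxnP (ex_intro P _ P0) ubP) => m Pm mmax.
have pm : p < m := leq_trans ps0 (mmax _ P0).
have {Pm} := Pm; case/exists_inP=> u uU /exists_inP[w wW /existsP[s]].
case/and5P=> uw Nuw us Us /eqP sw.
have sz := size_tuple s.
have := @posa G p short conn u w s [set y in U | adj u y] [set y in W | adj w y] us Us sw.
rewrite /= sz ltnS pm => /(_ _ _ _ _ _ _ isT) H.
suff : #|[set y in U | adj u y]| + #|[set y in W | adj w y]| < p.
  by rewrite ltnNge (leq_trans pab) // leq_add ?Ua ?Wb.
apply: H; last 2 first.
- exact: leq_trans a0 (Ua _ uU).
- exact: leq_trans b0 (Wb _ wW).
- by move=> y; rewrite inE => /andP[].
- by move=> y; rewrite inE => /andP[].
- move=> y; rewrite inE => /andP[yU uy]; apply: contraT => yQ.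
  have yw : y != w by apply: contraNneq Nuw => <-.
  have ys : path (@apex_adj G) (Some y) (Some u :: s) by rewrite /= adj_sym uy.
  have Uy : uniq (Some y :: Some u :: s) by rewrite cons_uniq yQ.
  (* Prefixing [y] to the path either closes a cycle on more than [p.+1] vertices or gives a
     nonadjacent pair with a longer path. *)
  have [ywa|Nyw] := boolP (adj y w).
    have := @apex_cycle G p short (Some y :: Some u :: s).
    rewrite /cycle rcons_path ys /= sw /= adj_sym ywa sz => /(_ isT Uy).
    by rewrite ltnS => mp; have := leq_trans (leqW pm) mp; rewrite ltnn.
  by have := mmax _ (PI y w _ yU wW yw Nyw ys Uy sw); rewrite /= sz ltnn.
- move=> y; rewrite inE => /andP[yW wy]; apply: contraT => yQ.
  have uy : u != y by apply: contraNneq Nuw => ->; rewrite adj_sym.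
  have ys : path (@apex_adj G) (Some u) (rcons s (Some y)) by rewrite rcons_path us sw.
  have Uy : uniq (Some u :: rcons s (Some y)) by rewrite -rcons_cons rcons_uniq yQ.
  have [uya|Nuy] := boolP (adj u y).
    have := @apex_cycle G p short (Some u :: rcons s (Some y)).
    rewrite /cycle rcons_path ys last_rcons /= adj_sym uya size_rcons sz => /(_ isT Uy).
    by rewrite ltnS => mp; have := leq_trans (leqW pm) mp; rewrite ltnn.
  have := mmax _ (PI u y _ uU yW uy Nuy ys Uy (last_rcons _ _ _)).
  by rewrite size_rcons sz ltnn.
Qed.

Lemma clique_size (K : {set G}) :
  {in K &, forall u v, u != v -> adj u v} -> #|K| <= p.
Proof.
move=> Kadj; rewrite cardE.
have [->//|K0] := eqVneq (enum K) [::].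
apply: short; rewrite is_pathE K0 enum_uniq andbT /=.
have : {subset enum K <= K} by move=> x; rewrite mem_enum.
have := enum_uniq K; elim: (enum K) => //= x [|y s] IH //= /andP[xs Us] sK.
have -> : path adj y s by apply: IH => // z zs; apply: sK; rewrite inE zs orbT.
rewrite andbT; apply: Kadj; rewrite ?sK ?inE ?eqxx ?orbT //.
by apply: contraNneq xs => ->; rewrite mem_head.
Qed.

Lemma sparse_sets (k : nat) :
    0 < p < #|G| -> (forall v : G, k <= degree v) ->
  exists2 j, j = (p - 1) %/ 2 \/ k <= j <= (p - 1) %/ 2 &
    forall U : {set G}, p - j < #|U| ->
      exists2 w, w \in U & #|[set v in U | adj w v]| <= j.
Proof.
move=> /andP[p0 pG] kdeg; set t := (p - 1) %/ 2.
have tp : p <= t.+1 + t.+1 by rewrite /t; lia.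
pose dense (j : nat) (U : {set G}) := [forall w in U, j < #|[set v in U | adj w v]|].
have sparse j m : (forall U : {set G}, m < #|U| -> ~~ dense j U) ->
    forall U : {set G}, m < #|U| -> exists2 w, w \in U & #|[set v in U | adj w v]| <= j.
  by move=> H U /H/forall_inPn[w wU]; rewrite -leqNgt; exists w.
have dense0 : dense t set0 by apply/forall_inP=> w; rewrite inE.
have [H Hdense Hmax] := arg_maxnP (fun S : {set G} => #|S|) dense0.
have {}Hmax (S : {set G}) : dense t S -> #|S| <= #|H| by apply: Hmax.
have [H0|/set0Pn[x0 x0H]] := eqVneq H set0.
  exists t; first by left.
  apply: sparse => U pU; apply/negP=> /Hmax; rewrite H0 cards0 leqn0 => /eqP U0.
  by rewrite U0 in pU.
have Hdeg := forall_inP Hdense.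
have Hcl : {in H &, forall u v, u != v -> adj u v}.
  by apply: (@dense_sets_joined H H t.+1 t.+1).
have hp := clique_size Hcl.
have HclE x : x \in H -> [set y in H | adj x y] = H :\ x.
  move=> xH; apply/setP=> y; rewrite !inE andbC.
  case: eqVneq => [->|yx]; rewrite ?adj_irr //=.
  by have [yH|] := boolP (y \in H); rewrite ?andbF // andbT; apply: Hcl => //; rewrite eq_sym.
have cardH x : x \in H -> #|H| = #|[set y in H | adj x y]|.+1.
  by move=> xH; rewrite HclE // (cardsD1 x H) xH.
have th : t.+1 < #|H| by rewrite (cardH _ x0H) ltnS Hdeg.
(* The clique [H] has minimum degree [#|H| - 1], which with [p - #|H| + 1] adds up to [p]. So a
   dense [U] is joined to [H], and a vertex of [U] outside [H] could be added to [H], against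
   maximality. *)
have large (U : {set G}) : #|H| < #|U| -> ~~ dense (p - #|H|) U.
  move=> HU; apply/negP=> /forall_inP Udeg.
  have joined : {in H & U, forall u w, u != w -> adj u w}.
    apply: (@dense_sets_joined H U #|H|.-1 (p - #|H|).+1) => //; try lia.
    by move=> x xH; rewrite (cardH x xH).
  have /subsetPn[y yU yH] : ~~ (U \subset H).
    by apply: contraL HU => /subset_leq_card; rewrite -leqNgt.
  have: dense t (y |: H).
    apply/forall_inP=> x; rewrite in_setU1 => /predU1P[->|xH].
      apply: leq_trans (ltnW th) _; apply/subset_leq_card/subsetP=> z zH.
      rewrite !inE zH orbT adj_sym joined //.
      by apply: contraNneq yH => <-.
    apply: leq_trans (Hdeg x xH) _; apply/subset_leq_card/subsetP=> z.
    by rewrite !inE => /andP[-> ->]; rewrite orbT.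
  by move/Hmax; rewrite cardsU1 yH add1n ltnn.
exists (p - #|H|); last first.
  by rewrite subKn //; apply: sparse.
right; apply/andP; split; last by lia.
rewrite leqNgt; apply/negP=> jk.
(* If [p - #|H| < k], the whole vertex set would be dense, yet it is larger than [H]. *)
have HT : #|H| < #|[set: G]| by rewrite cardsT (leq_ltn_trans hp).
case/negP: (large _ HT).
apply/forall_inP=> w _; apply: leq_trans jk _; apply: leq_trans (kdeg w) _.
by rewrite /degree; apply/subset_leq_card/subsetP=> v; rewrite !inE.
Qed.

End Core.

(** * The extremal graph attains the bound *)

Section Extremal.
Variables (H : sgraph) (n p i : nat).
Hypotheses (ip : i.*2 < p) (pn : p <= n).

(** The two complete parts form a clique on [i + (p - 2 * i) = p - i] vertices; the edgeless part is
    put back vertex by vertex, and [J] is adjacent to everything. *)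
Lemma removal_bound_le_extremal :
    (forall x y z : H, adj y z -> adj x y || adj x z) ->
  removal_bound H n (p - i) i
    <= #|embeddings H (@adj (extremal_graph n (p - 1) i)) setT|.
Proof.
move=> multi; pose X := extremal_graph n (p - 1) i.
pose J : {set X} := [set inl x | x in [set: 'I_i]].
pose B : {set X} := [set inr (inl x) | x in [set: 'I_(p - 1 + 1 - 2 * i)]].
have cJ : #|J| = i by rewrite card_imset ?cardsT ?card_ord // => x y [].
have cB : #|B| = p - 1 + 1 - 2 * i by rewrite card_imset ?cardsT ?card_ord // => x y [].
have cA : #|J :|: B| = p - i.
  rewrite cardsU cJ cB (_ : J :&: B = set0) ?cards0; last first.
    apply/setP=> v; rewrite in_set0; apply/negP=> /setIP[/imsetP[x _ ->] /imsetP[]] //.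
  lia.
have cX : #|[set: X]| = n.
  rewrite cardsT /= card_sum card_ord card_sum !card_ord; lia.
have := @removal_bound_le_embeddings H X adj J (J :|: B) setT multi (subsetUl _ _) (subsetT _).
rewrite cJ cA cX; apply.
  move=> u v /setUP[]/imsetP[x _ ->] /setUP[]/imsetP[y _ ->] //.
by move=> u /imsetP[x _ ->] [y|y] //= xy; rewrite /complete_adj [y == x]eq_sym andbb.
Qed.

End Extremal.

(** * Detour order, minimum degree and the final assembly *)

Section Detour.
Variable G : sgraph.

Lemma path_detour_order (q : seq G) : is_path q -> size q <= detour_order G.
Proof.
move=> qP; have qG : size q < #|G|.+1.
  have /and3P[_ _ qU] : [&& q != [::], sorted adj q & uniq q] by rewrite -is_pathE.
  by rewrite ltnS -(card_uniqP qU) max_card.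
apply: (@bigmax_sup _ (Ordinal qG)) => //.
by apply/existsP; exists (in_tuple q).
Qed.

Lemma detour_order_path : 0 < #|G| -> exists2 q : seq G, is_path q & size q = detour_order G.
Proof.
case/card_gt0P=> x _; rewrite /detour_order.
have P1 : [exists q : 1.-tuple G, is_path q] by apply/existsP; exists [tuple x].
have G1 : 1 < #|G|.+1 by rewrite ltnS; apply/card_gt0P; exists x.
have [|m /existsP[q qP] ->] := @eq_bigmax_cond _
  [pred m : 'I_(#|G|.+1) | [exists q : m.-tuple G, is_path q]] (@nat_of_ord _).
  by apply/card_gt0P; exists (Ordinal G1).
by exists q; rewrite ?size_tuple.
Qed.

Lemma min_degree_leq (v : G) : min_degree G <= degree v.
Proof.
rewrite /min_degree; have := mem_index_enum v.
elim: (index_enum _) => //= x s IH; rewrite big_cons inE => /predU1P[->|/IH].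
  exact: geq_minl.
by apply: leq_trans (geq_minr _ _).
Qed.

End Detour.

Theorem theorem2 (s : nat) (r : 'I_s -> nat) (G : sgraph) (n p k : nat)
    (s_gt0 : 0 < s) (r_gt0 : forall i : 'I_s, 0 < r i)
    (G_connected : connected G) (G_nontraceable : nontraceable G)
    (G_order : #|G| = n) (G_detour : detour_order G = p)
    (G_degree : k <= min_degree G) :
  nb_subgraphs (complete_multipartite r) G
    <= maxn (g_multipartite r n (p - 1) k)
            (g_multipartite r n (p - 1) ((p - 1) %/ 2)).
Proof.
case: G_connected => G0 Gconn; set H := complete_multipartite r.
have multi (x y z : H) : adj y z -> adj x y || adj x z.
  rewrite /= /multipartite_adj -negb_and; apply: contra => /andP[/eqP<- /eqP<-].
  exact: eqxx.
have short (q : seq G) : is_path q -> size q <= p by rewrite -G_detour; apply: path_detour_order.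
have [q0 q0P q0p] := detour_order_path G0; rewrite G_detour in q0p.
have p0 : 0 < p by rewrite -q0p; case: (q0) q0P.
have q0U : uniq q0 by move: q0P; rewrite is_pathE => /and3P[].
(* A longest path on all [#|G|] vertices would be a Hamilton path. *)
have pG : p < #|G|.
  rewrite -q0p -(card_uniqP q0U) ltnNge; apply/negP=> Gq.
  case: G_nontraceable; exists q0; split=> // x.
  have qG : #|q0| = #|G| by apply/eqP; rewrite eqn_leq max_card.
  by rewrite (subset_cardP qG (subset_predT _)).
have [e [eS [eI [sub eshort esat]]]] := saturated_supergraph short.
pose G' := SGraph eS eI.
have conn (x y : G') : connect adj x y.
  by apply: (@connect_sub _ (@adj G)) (Gconn x y) => a b /sub ab; apply: connect1.
have kdeg (v : G') : k <= degree v.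
  apply: leq_trans (leq_trans G_degree (@min_degree_leq G v)) _.
  by apply/subset_leq_card/subsetP=> w; rewrite !inE; apply: sub.
have p0G : 0 < p < #|G'| by rewrite p0.
have [j jt sparse] := sparse_sets eshort conn esat p0G kdeg.
set t := (p - 1) %/ 2 in jt *.
have tp : t.*2 < p by rewrite /t; lia.
have pn : p <= n by rewrite -G_order ltnW.
have jp : p - j <= #|[set: G']| by rewrite cardsT; apply: leq_trans (leq_subr _ _) (ltnW pG).
have emb : #|embeddings H (@adj G) setT| <= removal_bound H n (p - j) j.
  apply: leq_trans (leq_embeddings _ _ sub) _; rewrite -G_order -cardsT.
  exact: (@embeddings_le_removal_bound H G' adj).
have ext i : i <= t -> removal_bound H n (p - i) i
    <= g_multipartite r n (p - 1) i * #|automorphisms H|.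
  move=> it; rewrite nb_subgraphs_automorphisms; apply: removal_bound_le_extremal => //.
  by apply: leq_ltn_trans tp; rewrite leq_double.
(* Multiplying by the number of automorphisms of [H] turns all counts of copies into counts of
   embeddings. *)
rewrite -(leq_pmul2r (automorphisms_gt0 H)) nb_subgraphs_automorphisms maxnMl.
apply: leq_trans emb _; case: jt => [->|kjt].
  by apply: leq_trans (ext t (leqnn t)) (leq_maxr _ _).
apply: leq_trans (removal_bound_convex H pn kjt tp) _; have /andP[kj jt] := kjt.
by rewrite geq_max !leq_max !ext ?orbT // (leq_trans kj).
Qed.
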